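(* Let $A$ be an algebra over a commutative ring $k$. Then the closed structure of ${}_k\mathcal{M}$ lifts to a left skew-closed structure on ${}_A\mathcal{M}$ if and only if: (1) there exists an algebra map $\varepsilon\colon A\to k$ (i.e. $(A,\varepsilon)$ is an augmented $k$-algebra), and (2) there exists an algebra map $\delta\colon A\to A\otimes A^{\mathrm{op}}$, written $\delta(a)=a_+\otimes a_-$ (summation understood), and they satisfy, for all $a\in A$, $$a_+\,\varepsilon(a_-)=a,$$ $$a_+a_-=\varepsilon(a)1_A,$$ $$a_{++}\otimes a_{-+}\otimes a_{--}a_{+-}=a_+\otimes a_-\otimes 1 .$$ In this case, $A$ acts on $[M,V]=\mathrm{Hom}_k(M,V)$, for $M,V\in{}_A\mathcal{M}$, by $(a.f)(m)=a_+f(a_-m)$.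
   Context: Algebras are associative and unital, $\otimes=\otimes_k$, and ${}_k\mathcal{M}$, ${}_A\mathcal{M}$ are the categories of left $k$-modules and left $A$-modules. Sweedler-type notation: $\delta(a_+)=a_{++}\otimes a_{+-}$ and $\delta(a_-)=a_{-+}\otimes a_{--}$, so that $a_{++}\otimes a_{+-}\otimes a_{-+}\otimes a_{--}=(\delta\otimes\delta)(\delta(a))$. A (left) skew-closed category is a category $\mathcal{C}$ with an object $\mathbf{1}$, a functor $[-,-]\colon\mathcal{C}^{\mathrm{op}}\times\mathcal{C}\to\mathcal{C}$, a natural transformation $i_X\colon[\mathbf{1},X]\to X$, a dinatural transformation $j_X\colon\mathbf{1}\to[X,X]$, and morphisms $\Gamma^X_{Y,Z}\colon[Y,Z]\to[[X,Y],[X,Z]]$ natural in $Y,Z$ and dinatural in $X$, such that: $i_{\mathbf{1}}\circ j_{\mathbf{1}}=\mathrm{id}_{\mathbf 1}$; $i_{[X,Y]}\circ[j_X,[X,Y]]\circ\Gamma^X_{X,Y}=\mathrm{id}_{[X,Y]}$; $\Gamma^X_{Y,Y}\circ j_Y=j_{[X,Y]}$; $[[\mathbf{1},X],i_Y]\circ\Gamma^{\mathbf{1}}_{X,Y}=[i_X,Y]$; and $[\Gamma^U_{V,W},[[U,V],[U,X]]]\circ\Gamma^{[U,V]}_{[U,W],[U,X]}\circ\Gamma^U_{W,X}=[[V,W],\Gamma^U_{V,X}]\circ\Gamma^V_{W,X}$ (an object in a slot of $[-,-]$ stands for its identity). A functor $F\colon\mathcal{C}\to\mathcal{D}$ between skew-closed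 categories is strictly closed if $F\mathbf{1}=\mathbf{1}$, $F[X,Y]=[FX,FY]$ (naturally in $X,Y$), $F(i_X)=i_{FX}$, $F(j_X)=j_{FX}$ and $F(\Gamma^X_{Y,Z})=\Gamma^{FX}_{FY,FZ}$. The closed structure on ${}_k\mathcal{M}$ is $[M,N]=\mathrm{Hom}_k(M,N)$, $\mathbf{1}=k$, $i_M(f)=f(1)$, $j_M(1)=\mathrm{id}_M$, $\Gamma^M_{N,P}(f)=f\circ-$. That it lifts to ${}_A\mathcal{M}$ means that there is a left skew-closed structure on ${}_A\mathcal{M}$ for which the forgetful functor ${}_A\mathcal{M}\to{}_k\mathcal{M}$ is strictly closed. *)

(* Defs.v *)
From HB Require Import structures.
From mathcomp Require Import all_boot all_order all_algebra.
From mathcomp Require Import generic_quotient.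
From mathcomp Require Import boolp.

Set Implicit Arguments.
Unset Strict Implicit.
Unset Printing Implicit Defensive.

Import GRing.Theory.
Local Open Scope ring_scope.
Local Open Scope quotient_scope.

Reserved Notation "x ∙ y" (at level 40, left associativity).
Reserved Notation "x ⊗ y" (at level 38, right associativity).
Reserved Notation "A ^op" (at level 1, left associativity, format "A ^op").
Reserved Notation "g ∘ f" (at level 40, left associativity).
Reserved Notation "\sweedler_ ( p ⊗ q <- t ) E"
  (at level 41, p name, q name, t at level 200, E at level 41, right associativity,
   format "'[' \sweedler_ ( p  ⊗  q  <-  t ) '/  '  E ']'").

Section LinearMaps.
Variables (k : comPzRingType).
Implicit Types (M N P : lmodType k).

Lemma linear_eq M N (f g : {linear M -> N}) : f =1 g -> f = g.
Proof.
case: f g => [f [[fa] [fs]]] [g [[ga] [gs]]] /= /funext eq_fg.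
case: g / eq_fg in ga gs *.
by rewrite (Prop_irrelevance fa ga) (Prop_irrelevance fs gs).
Qed.

Definition to_linear M N (f : M -> N) (f_lin : linear f) : {linear M -> N} :=
  HB.pack f (GRing.isLinear.Build k M N *:%R f f_lin).

Definition is_bilinear M N P (f : M -> N -> P) : Prop :=
  (forall n, linear (f^~ n)) /\ (forall m, linear (f m)).

End LinearMaps.

Section HomModule.
Variables (k : comPzRingType) (M N : lmodType k).
Implicit Types (f g : {linear M -> N}) (c : k).

HB.instance Definition _ := gen_eqMixin {linear M -> N}.
HB.instance Definition _ := gen_choiceMixin {linear M -> N}.

Definition hom_zero : {linear M -> N} := \0.
Definition hom_opp f : {linear M -> N} := \- f.
Definition hom_add f g : {linear M -> N} := f \+ g.

Fact hom_addA : associative hom_add.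
Proof. by move=> f g h; apply: linear_eq => x /=; rewrite addrA. Qed.
Fact hom_addC : commutative hom_add.
Proof. by move=> f g; apply: linear_eq => x /=; rewrite addrC. Qed.
Fact hom_add0 : left_id hom_zero hom_add.
Proof. by move=> f; apply: linear_eq => x /=; rewrite add0r. Qed.
Fact hom_addN : left_inverse hom_zero hom_opp hom_add.
Proof. by move=> f; apply: linear_eq => x /=; rewrite addNr. Qed.

HB.instance Definition _ := GRing.isZmodule.Build {linear M -> N}
  hom_addA hom_addC hom_add0 hom_addN.

Fact hom_scale_subproof c f : linear (fun x => c *: f x).
Proof. by move=> a x y; rewrite linearP scalerDr !scalerA mulrC. Qed.
Definition hom_scale c f : {linear M -> N} :=
  to_linear (hom_scale_subproof c f).

Fact hom_scaleA a b f : hom_scale a (hom_scale b f) = hom_scale (a * b) f.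
Proof. by apply: linear_eq => x /=; rewrite scalerA. Qed.
Fact hom_scale1 : left_id 1 hom_scale.
Proof. by move=> f; apply: linear_eq => x /=; rewrite scale1r. Qed.
Fact hom_scaleDr : right_distributive hom_scale +%R.
Proof. by move=> c f g; apply: linear_eq => x /=; rewrite scalerDr. Qed.
Fact hom_scaleDl f : {morph hom_scale^~ f : a b / a + b}.
Proof. by move=> a b; apply: linear_eq => x /=; rewrite scalerDl. Qed.

HB.instance Definition _ := GRing.Zmodule_isLmodule.Build k {linear M -> N}
  hom_scaleA hom_scale1 hom_scaleDr hom_scaleDl.

Lemma hom_addE f g x : (f + g) x = f x + g x. Proof. by []. Qed.
Lemma hom_scaleE c f x : (c *: f) x = c *: f x. Proof. by []. Qed.

End HomModule.

(* M ⊗ N is the quotient of the formal finite sums of pairs by the congruence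
   generated by the bilinearity relations. *)
Section Tensor.
Variables (k : comPzRingType) (M N : lmodType k).

Inductive tensor_eqv : seq (M * N) -> seq (M * N) -> Prop :=
| tensor_eqv_refl s : tensor_eqv s s
| tensor_eqv_sym s t : tensor_eqv s t -> tensor_eqv t s
| tensor_eqv_trans s t u : tensor_eqv s t -> tensor_eqv t u -> tensor_eqv s u
| tensor_eqv_cat s s' t t' :
    tensor_eqv s s' -> tensor_eqv t t' -> tensor_eqv (s ++ t) (s' ++ t')
| tensor_eqv_comm s t : tensor_eqv (s ++ t) (t ++ s)
| tensor_eqv_Dl m m' n : tensor_eqv [:: (m + m', n)] [:: (m, n); (m', n)]
| tensor_eqv_Dr m n n' : tensor_eqv [:: (m, n + n')] [:: (m, n); (m, n')]
| tensor_eqv_Z c m n : tensor_eqv [:: (c *: m, n)] [:: (m, c *: n)]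
| tensor_eqv_0 n : tensor_eqv [:: (0, n)] [::].

Definition tensor_rel (s t : seq (M * N)) : bool := `[< tensor_eqv s t >].

Fact tensor_rel_refl : reflexive tensor_rel.
Proof. by move=> s; apply/asboolP; apply: tensor_eqv_refl. Qed.
Fact tensor_rel_sym : symmetric tensor_rel.
Proof. by move=> s t; apply/asboolP/asboolP; apply: tensor_eqv_sym. Qed.
Fact tensor_rel_trans : transitive tensor_rel.
Proof.
move=> t s u /asboolP st /asboolP tu; apply/asboolP.
exact: tensor_eqv_trans st tu.
Qed.

Canonical tensor_equiv :=
  EquivRel tensor_rel tensor_rel_refl tensor_rel_sym tensor_rel_trans.

Definition tensor := {eq_quot tensor_rel}.
HB.instance Definition _ := Choice.on tensor.
HB.instance Definition _ := EqQuotient.on tensor.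

Lemma tensor_piE (s t : seq (M * N)) :
  \pi_tensor s = \pi_tensor t <-> tensor_eqv s t.
Proof.
split=> [/eqP|st]; first by rewrite eqmodE => /asboolP.
by apply/eqP; rewrite eqmodE; apply/asboolP.
Qed.

Lemma tensor_reprP (s : seq (M * N)) : tensor_eqv (repr (\pi_tensor s)) s.
Proof. by apply/tensor_piE; rewrite reprK. Qed.

Definition tensor_zero : tensor := \pi_tensor [::].
Definition tensor_add (x y : tensor) : tensor := \pi_tensor (repr x ++ repr y).
Definition tensor_scale (c : k) (x : tensor) : tensor :=
  \pi_tensor [seq (c *: p.1, p.2) | p <- repr x].
Definition tensor_opp (x : tensor) : tensor := tensor_scale (- 1) x.
Definition pure (m : M) (n : N) : tensor := \pi_tensor [:: (m, n)].

Lemma tensor_pi_cat s t :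
  tensor_add (\pi_tensor s) (\pi_tensor t) = \pi_tensor (s ++ t).
Proof. by apply/tensor_piE/tensor_eqv_cat; apply: tensor_reprP. Qed.

Lemma tensor_eqv_scale c s t : tensor_eqv s t ->
  tensor_eqv [seq (c *: p.1, p.2) | p <- s] [seq (c *: p.1, p.2) | p <- t].
Proof.
elim=> {s t} [s|s t _|s t u _ st _ tu|s s' t t' _ IHs _ IHt|s t|m m' n|m n n'
            |d m n|n] /=.
- exact: tensor_eqv_refl.
- exact: tensor_eqv_sym.
- exact: tensor_eqv_trans st tu.
- by rewrite !map_cat; apply: tensor_eqv_cat.
- by rewrite !map_cat; apply: tensor_eqv_comm.
- by rewrite scalerDr; apply: tensor_eqv_Dl.
- exact: tensor_eqv_Dr.
- by rewrite scalerA mulrC -scalerA; apply: tensor_eqv_Z.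
- by rewrite scaler0; apply: tensor_eqv_0.
Qed.

Lemma tensor_pi_scale c s :
  tensor_scale c (\pi_tensor s) = \pi_tensor [seq (c *: p.1, p.2) | p <- s].
Proof. by apply/tensor_piE/tensor_eqv_scale/tensor_reprP. Qed.

Lemma tensor_eqv_scaleD a b s :
  tensor_eqv [seq ((a + b) *: p.1, p.2) | p <- s]
    ([seq (a *: p.1, p.2) | p <- s] ++ [seq (b *: p.1, p.2) | p <- s]).
Proof.
elim: s => [|[m n] s IHs] /=; first exact: tensor_eqv_refl.
rewrite scalerDl.
have head : tensor_eqv [:: (a *: m + b *: m, n)] [:: (a *: m, n); (b *: m, n)].
  exact: tensor_eqv_Dl.
apply: tensor_eqv_trans (tensor_eqv_cat head IHs) _ => /=.
set sa := [seq (a *: _, _) | _ <- _]; set sb := [seq (b *: _, _) | _ <- _].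
have := tensor_eqv_cat (tensor_eqv_comm [:: (b *: m, n)] sa)
  (tensor_eqv_refl sb).
by move/(tensor_eqv_cat (tensor_eqv_refl [:: (a *: m, n)])); rewrite -!catA.
Qed.

Fact tensor_addA : associative tensor_add.
Proof.
elim/quotW=> x; elim/quotW=> y; elim/quotW=> z.
by rewrite (tensor_pi_cat y z) (tensor_pi_cat x y) !tensor_pi_cat catA.
Qed.
Fact tensor_addC : commutative tensor_add.
Proof.
elim/quotW=> x; elim/quotW=> y; rewrite !tensor_pi_cat.
by apply/tensor_piE; apply: tensor_eqv_comm.
Qed.
Fact tensor_add0 : left_id tensor_zero tensor_add.
Proof. by elim/quotW=> x; rewrite tensor_pi_cat. Qed.
Fact tensor_scale1 : left_id 1 tensor_scale.
Proof.
elim/quotW=> x; rewrite tensor_pi_scale.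
by rewrite (eq_map (g := id)) ?map_id // => -[m n] /=; rewrite scale1r.
Qed.
Fact tensor_scaleDl x a b :
  tensor_scale (a + b) x = tensor_add (tensor_scale a x) (tensor_scale b x).
Proof.
elim/quotW: x => x; rewrite !tensor_pi_scale tensor_pi_cat.
by apply/tensor_piE; apply: tensor_eqv_scaleD.
Qed.
Fact tensor_scaleDr : right_distributive tensor_scale tensor_add.
Proof.
move=> c; elim/quotW=> x; elim/quotW=> y; rewrite (tensor_pi_cat x y).
by rewrite (tensor_pi_scale c x) (tensor_pi_scale c y) tensor_pi_scale
  tensor_pi_cat map_cat.
Qed.
Fact tensor_addN : left_inverse tensor_zero tensor_opp tensor_add.
Proof.
move=> x; rewrite -{2}[x]tensor_scale1 -tensor_scaleDl addNr.
elim/quotW: x => x; rewrite tensor_pi_scale; apply/tensor_piE.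
elim: x => [|[m n] s IHs] /=; first exact: tensor_eqv_refl.
rewrite scale0r -cat1s -[X in tensor_eqv _ X]cats0.
by apply: tensor_eqv_cat => //; apply: tensor_eqv_0.
Qed.

HB.instance Definition _ := GRing.isZmodule.Build tensor
  tensor_addA tensor_addC tensor_add0 tensor_addN.

Fact tensor_scaleA a b x :
  tensor_scale a (tensor_scale b x) = tensor_scale (a * b) x.
Proof.
elim/quotW: x => x; rewrite (tensor_pi_scale b x) !tensor_pi_scale -map_comp.
by congr (\pi_tensor _); apply: eq_map => -[m n] /=; rewrite scalerA.
Qed.

HB.instance Definition _ := GRing.Zmodule_isLmodule.Build k tensor
  tensor_scaleA tensor_scale1 tensor_scaleDr tensor_scaleDl.

Lemma pure_bilinear : is_bilinear pure.
Proof.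
split=> [n c m m'|m c n n'].
  transitivity (tensor_add (tensor_scale c (pure m n)) (pure m' n)) => //.
  rewrite tensor_pi_scale tensor_pi_cat; apply/tensor_piE.
  exact: tensor_eqv_Dl.
transitivity (tensor_add (tensor_scale c (pure m n)) (pure m n')) => //.
rewrite tensor_pi_scale tensor_pi_cat; apply/tensor_piE.
apply: tensor_eqv_trans (tensor_eqv_Dr _ _ _) _.
rewrite -[X in tensor_eqv X _]cat1s -[X in tensor_eqv _ X]cat1s.
apply: tensor_eqv_cat; last exact: tensor_eqv_refl.
by apply: tensor_eqv_sym; apply: tensor_eqv_Z.
Qed.

Lemma tensor_ind (Q : tensor -> Prop) :
  Q 0 -> (forall m n x, Q x -> Q (pure m n + x)) -> forall x, Q x.
Proof.
move=> Q0 QD; elim/quotW; elim=> [|[m n] s IHs] //.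
by rewrite -cat1s -tensor_pi_cat; apply: QD.
Qed.

(* \sum_i f m_i n_i for x = \sum_i m_i ⊗ n_i; the choice of a decomposition is
   immaterial when f is bilinear, by [tensor_sum_linear] and
   [tensor_sum_pure], which is the only case in which it is used. *)
Definition tensor_sum (P : lmodType k) (f : M -> N -> P) (x : tensor) : P :=
  \sum_(p <- repr x) f p.1 p.2.

Lemma tensor_sum_pi (P : lmodType k) (f : M -> N -> P) s : is_bilinear f ->
  tensor_sum f (\pi_tensor s) = \sum_(p <- s) f p.1 p.2.
Proof.
case=> fl fr; have fDl m m' n : f (m + m') n = f m n + f m' n.
  by rewrite -[m]scale1r fl !scale1r.
have fDr m n n' : f m (n + n') = f m n + f m n'.
  by rewrite -[n]scale1r fr !scale1r.
have f0l n : f 0 n = 0 by apply: (addrI (f 0 n)); rewrite -fDl !addr0.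
have f0r m : f m 0 = 0 by apply: (addrI (f m 0)); rewrite -fDr !addr0.
suff sum_eqv s1 s2 : tensor_eqv s1 s2 ->
    \sum_(p <- s1) f p.1 p.2 = \sum_(p <- s2) f p.1 p.2.
  exact: sum_eqv (tensor_reprP s).
elim=> {s s1 s2} // [s t u _ -> _ -> //|s s' t t' _ IHs _ IHt|s t|m m' n
  |m n n'|c m n|n].
- by rewrite !big_cat /= IHs IHt.
- by rewrite !big_cat /= addrC.
- by rewrite !big_cons !big_nil /= !addr0 fDl.
- by rewrite !big_cons !big_nil /= !addr0 fDr.
- rewrite !big_cons !big_nil /= !addr0.
  by rewrite -[c *: m]addr0 fl f0l -[c *: n]addr0 fr f0r.
- by rewrite !big_cons !big_nil /= f0l addr0.
Qed.

Lemma tensor_sum_pure (P : lmodType k) (f : M -> N -> P) m n :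
  is_bilinear f -> tensor_sum f (pure m n) = f m n.
Proof. by move=> fb; rewrite tensor_sum_pi // big_cons big_nil addr0. Qed.

Lemma tensor_sum_linear (P : lmodType k) (f : M -> N -> P) :
  is_bilinear f -> linear (tensor_sum f).
Proof.
move=> fb c x y.
have -> : c *: x + y = tensor_add (tensor_scale c x) y by [].
elim/quotW: x => x; elim/quotW: y => y.
rewrite tensor_pi_scale tensor_pi_cat !tensor_sum_pi //.
rewrite big_cat big_map scaler_sumr /=; congr (_ + _).
apply: eq_bigr => -[m n] _ /=; case: fb => fl _.
have f0 : f 0 n = 0.
  apply: (addrI (f 0 n)); rewrite addr0.
  by have := fl n 1 0 0; rewrite !scale1r addr0.
by rewrite -[c *: m]addr0 fl f0 addr0.
Qed.

Lemma tensor_sum_family (U P : lmodType k) (F : U -> M -> N -> P) x :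
  (forall m n, linear (fun u => F u m n)) ->
  linear (fun u => tensor_sum (F u) x).
Proof.
move=> Flin c u v; rewrite /tensor_sum scaler_sumr -big_split /=.
by apply: eq_bigr => p _; apply: Flin.
Qed.

Lemma tensor_linear_eq (P : lmodType k) (f g : tensor -> P) :
  linear f -> linear g -> (forall m n, f (pure m n) = g (pure m n)) -> f =1 g.
Proof.
move=> fl gl fg; elim/tensor_ind=> [|m n x IHx].
  suff lin0 (h : tensor -> P) : linear h -> h 0 = 0 by rewrite !lin0.
  move=> hl; apply: (addrI (h 0)); rewrite addr0.
  by have := hl 1 0 0; rewrite !scale1r addr0.
by rewrite -[pure m n]scale1r fl gl fg IHx.
Qed.

End Tensor.

Notation "x ⊗ y" := (pure x y) : ring_scope.
Notation "M ⊗ N" := (tensor M N) : type_scope.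

(* The library's [algType] excludes the zero ring, hence this structure of
   arbitrary associative unital algebras. *)
HB.mixin Record isAlgebra (k : comPzRingType) A of GRing.Lmodule k A := {
  unit_elt : A;
  amul : A -> A -> A;
  amulA : associative amul;
  amul1l : left_id unit_elt amul;
  amul1r : right_id unit_elt amul;
  amul_bilinear : is_bilinear amul
}.

#[short(type="algebra")]
HB.structure Definition KAlgebra (k : comPzRingType) :=
  {A of GRing.Lmodule k A & isAlgebra k A}.

Notation "x ∙ y" := (amul x y) : ring_scope.

Definition algebra_map (k : comPzRingType) (A B : algebra k) (f : A -> B) :
    Prop :=
  [/\ linear f, f unit_elt = unit_elt & forall x y, f (x ∙ y) = f x ∙ f y].

Section BaseAlgebra.
Variable (k : comPzRingType).

Fact base_mul_bilinear : is_bilinear (fun x y : k^o => x * y : k^o).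
Proof.
split=> [y c x x'|x c y y']; first by rewrite mulrDl /GRing.scale /= mulrA.
by rewrite mulrDr /GRing.scale /= mulrCA.
Qed.
HB.instance Definition _ := @isAlgebra.Build k k^o 1 *%R
  (@mulrA k) (@mul1r k) (@mulr1 k) base_mul_bilinear.

End BaseAlgebra.

Section Opposite.
Variables (k : comPzRingType) (A : algebra k).

Definition opposite : Type := A.
HB.instance Definition _ := GRing.Lmodule.copy opposite A.

Definition op_mul (x y : opposite) : opposite := amul (y : A) (x : A).
Fact op_mulA : associative op_mul.
Proof. by move=> x y z; rewrite /op_mul amulA. Qed.
Fact op_mul1l : left_id (unit_elt : A) op_mul.
Proof. by move=> x; apply: amul1r. Qed.
Fact op_mul1r : right_id (unit_elt : A) op_mul.
Proof. by move=> x; apply: amul1l. Qed.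
Fact op_mul_bilinear : is_bilinear op_mul.
Proof.
by split=> [y c x x'|x c y y']; [apply: amul_bilinear.2|apply: amul_bilinear.1].
Qed.
HB.instance Definition _ := @isAlgebra.Build k opposite (unit_elt : A) op_mul
  op_mulA op_mul1l op_mul1r op_mul_bilinear.

End Opposite.

Notation "A ^op" := (opposite A) : type_scope.

Section TensorAlgebra.
Variables (k : comPzRingType) (A B : algebra k).

Definition tensor_mul (x y : A ⊗ B) : A ⊗ B :=
  tensor_sum (fun a b => tensor_sum (fun a' b' => (a ∙ a') ⊗ (b ∙ b')) y) x.

Fact tensor_mul_inner_bilinear y : is_bilinear (fun a b =>
  tensor_sum (fun a' b' => (a ∙ a') ⊗ (b ∙ b')) y : A ⊗ B).
Proof.
split=> [b|a]; apply: tensor_sum_family => a' b' c u v.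
  by rewrite (@amul_bilinear k A).1 (pure_bilinear A B).1.
by rewrite (@amul_bilinear k B).1 (pure_bilinear A B).2.
Qed.

Fact tensor_mul_pure_bilinear a b :
  is_bilinear (fun (a' : A) (b' : B) => (a ∙ a') ⊗ (b ∙ b') : A ⊗ B).
Proof.
split=> [b' c u v|a' c u v].
  by rewrite (@amul_bilinear k A).2 (pure_bilinear A B).1.
by rewrite (@amul_bilinear k B).2 (pure_bilinear A B).2.
Qed.

Fact tensor_mul_bilinear : is_bilinear tensor_mul.
Proof.
split=> [y|x]; first exact/tensor_sum_linear/tensor_mul_inner_bilinear.
apply: (tensor_sum_family (F := fun y a b => tensor_sum _ y)) => a b.
exact/tensor_sum_linear/tensor_mul_pure_bilinear.
Qed.

Lemma tensor_mul_pure a b a' b' :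
  tensor_mul (a ⊗ b) (a' ⊗ b') = (a ∙ a') ⊗ (b ∙ b').
Proof.
rewrite /tensor_mul tensor_sum_pure; last exact: tensor_mul_inner_bilinear.
by rewrite tensor_sum_pure //; apply: tensor_mul_pure_bilinear.
Qed.

Definition tensor_unit : A ⊗ B := unit_elt ⊗ unit_elt.

Let mul_linl y : linear (tensor_mul^~ y). Proof. exact: tensor_mul_bilinear.1. Qed.
Let mul_linr x : linear (tensor_mul x). Proof. exact: tensor_mul_bilinear.2. Qed.

Fact tensor_mulA : associative tensor_mul.
Proof.
move=> x y z; move: x; apply: tensor_linear_eq => [c u v|c u v|a b].
- by rewrite mul_linl.
- by rewrite !mul_linl.
move: y; apply: tensor_linear_eq => [c u v|c u v|a' b'].
- by rewrite mul_linl mul_linr.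
- by rewrite mul_linr mul_linl.
move: z; apply: tensor_linear_eq => [c u v|c u v|a'' b''].
- by rewrite !mul_linr.
- by rewrite mul_linr.
by rewrite !tensor_mul_pure !amulA.
Qed.
Fact tensor_mul1l : left_id tensor_unit tensor_mul.
Proof.
apply: tensor_linear_eq => // a b.
by rewrite tensor_mul_pure !amul1l.
Qed.
Fact tensor_mul1r : right_id tensor_unit tensor_mul.
Proof.
apply: (tensor_linear_eq (f := tensor_mul^~ tensor_unit)) => // a b.
by rewrite tensor_mul_pure !amul1r.
Qed.

HB.instance Definition _ := @isAlgebra.Build k (A ⊗ B)%type tensor_unit tensor_mul
  tensor_mulA tensor_mul1l tensor_mul1r tensor_mul_bilinear.

End TensorAlgebra.

(* \sum f t_+ t_- for t = \sum t_+ ⊗ t_-, where t_- is regarded as an element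
   of A, so that products formed in f are products of A and not of A^op. *)
Definition sweedler (k : comPzRingType) (A : algebra k) (P : lmodType k)
    (t : A ⊗ A^op) (f : A -> A -> P) : P := tensor_sum f t.

Notation "\sweedler_ ( p ⊗ q <- t ) E" := (sweedler t (fun p q => E)) :
  ring_scope.

Record category := Category {
  obj :> Type;
  mor : obj -> obj -> Type;
  idmap : forall X, mor X X;
  ccomp : forall X Y Z, mor Y Z -> mor X Y -> mor X Z;
  ccomp_id_l : forall X Y (f : mor X Y), ccomp (idmap Y) f = f;
  ccomp_id_r : forall X Y (f : mor X Y), ccomp f (idmap X) = f;
  ccomp_assoc : forall X Y Z W (h : mor Z W) (g : mor Y Z) (f : mor X Y),
    ccomp h (ccomp g f) = ccomp (ccomp h g) f
}.

Arguments idmap {c} X.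
Notation "g ∘ f" := (ccomp g f).

Record functor (C D : category) := Functor {
  fobj :> C -> D;
  fmap : forall X Y : C, mor X Y -> mor (fobj X) (fobj Y);
  fmap_id : forall X : C, fmap (idmap X) = idmap (fobj X);
  fmap_comp : forall (X Y Z : C) (g : mor Y Z) (f : mor X Y),
    fmap (g ∘ f) = fmap g ∘ fmap f
}.
Arguments fmap {C D} F {X Y} f : rename.

(* Equality of arrows (equal sources, equal targets, equal morphisms) when the
   sources and targets are not convertible. *)
Inductive mor_eq (C : category) (X Y : C) (f : mor X Y) :
    forall X' Y' : C, mor X' Y' -> Prop :=
| mor_eq_refl : mor_eq f f.

Record skew_closed (C : category) := SkewClosed {
  sc_one : C;
  ihom : C -> C -> C;
  ihom_map : forall X X' Y Y' : C,
    mor X' X -> mor Y Y' -> mor (ihom X Y) (ihom X' Y');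
  ihom_map_id : forall X Y,
    ihom_map (idmap X) (idmap Y) = idmap (ihom X Y);
  ihom_map_comp : forall X X' X'' Y Y' Y''
    (f : mor X' X) (f' : mor X'' X') (g : mor Y Y') (g' : mor Y' Y''),
    ihom_map (f ∘ f') (g' ∘ g) = ihom_map f' g' ∘ ihom_map f g;
  sc_i : forall X, mor (ihom sc_one X) X;
  sc_i_natural : forall X Y (f : mor X Y),
    f ∘ sc_i X = sc_i Y ∘ ihom_map (idmap sc_one) f;
  sc_j : forall X, mor sc_one (ihom X X);
  sc_j_dinatural : forall X Y (f : mor X Y),
    ihom_map (idmap X) f ∘ sc_j X = ihom_map f (idmap Y) ∘ sc_j Y;
  (* [sc_Gamma X Y Z] is Γ^X_{Y,Z} *)
  sc_Gamma : forall X Y Z, mor (ihom Y Z) (ihom (ihom X Y) (ihom X Z));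
  sc_Gamma_natural : forall X Y Y' Z Z' (g : mor Y' Y) (h : mor Z Z'),
    ihom_map (ihom_map (idmap X) g) (ihom_map (idmap X) h) ∘ sc_Gamma X Y Z =
    sc_Gamma X Y' Z' ∘ ihom_map g h;
  sc_Gamma_dinatural : forall X X' Y Z (f : mor X X'),
    ihom_map (ihom_map f (idmap Y)) (idmap (ihom X Z)) ∘ sc_Gamma X Y Z =
    ihom_map (idmap (ihom X' Y)) (ihom_map f (idmap Z)) ∘ sc_Gamma X' Y Z;
  sc_ax_ij : sc_i sc_one ∘ sc_j sc_one = idmap sc_one;
  sc_ax_ijGamma : forall X Y,
    sc_i (ihom X Y) ∘ ihom_map (sc_j X) (idmap (ihom X Y)) ∘ sc_Gamma X X Y =
    idmap (ihom X Y);
  sc_ax_Gammaj : forall X Y, sc_Gamma X Y Y ∘ sc_j Y = sc_j (ihom X Y);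
  sc_ax_iGamma : forall X Y,
    ihom_map (idmap (ihom sc_one X)) (sc_i Y) ∘ sc_Gamma sc_one X Y =
    ihom_map (sc_i X) (idmap Y);
  sc_ax_Gamma : forall U V W X,
    ihom_map (sc_Gamma U V W) (idmap (ihom (ihom U V) (ihom U X)))
      ∘ sc_Gamma (ihom U V) (ihom U W) (ihom U X) ∘ sc_Gamma U W X =
    ihom_map (idmap (ihom V W)) (sc_Gamma U V X) ∘ sc_Gamma V W X
}.

Arguments sc_one {C} s : rename.
Arguments ihom {C} s X Y : rename.
Arguments ihom_map {C} s {X X' Y Y'} f g : rename.
Arguments sc_i {C} s X : rename.
Arguments sc_j {C} s X : rename.
Arguments sc_Gamma {C} s X Y Z : rename.

Record strictly_closed (C D : category) (S : skew_closed C) (T : skew_closed D)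
    (F : functor C D) : Prop := StrictlyClosed {
  strict_one : F (sc_one S) = sc_one T;
  strict_ihom : forall X Y, F (ihom S X Y) = ihom T (F X) (F Y);
  strict_ihom_map : forall (X X' Y Y' : C) (f : mor X' X) (g : mor Y Y'),
    mor_eq (fmap F (ihom_map S f g)) (ihom_map T (fmap F f) (fmap F g));
  strict_i : forall X, mor_eq (fmap F (sc_i S X)) (sc_i T (F X));
  strict_j : forall X, mor_eq (fmap F (sc_j S X)) (sc_j T (F X));
  strict_Gamma : forall X Y Z,
    mor_eq (fmap F (sc_Gamma S X Y Z)) (sc_Gamma T (F X) (F Y) (F Z))
}.

Section KMod.
Variable (k : comPzRingType).

Definition lin_id (M : lmodType k) : {linear M -> M} := idfun.
Definition lin_comp (M N P : lmodType k) (g : {linear N -> P})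
    (f : {linear M -> N}) : {linear M -> P} := g \o f.

Definition kMod : category.
Proof.
refine (@Category (lmodType k) (fun M N => {linear M -> N}) lin_id lin_comp
  _ _ _); by move=> *; apply: linear_eq.
Defined.

Implicit Types (M N P : lmodType k).

Fact hom_map_subproof M M' N N' (f : {linear M' -> M}) (g : {linear N -> N'}) :
  linear (fun h : {linear M -> N} => lin_comp g (lin_comp h f)).
Proof. by move=> c h h'; apply: linear_eq => x /=; rewrite linearP. Qed.
Definition hom_map M M' N N' (f : {linear M' -> M}) (g : {linear N -> N'}) :
    {linear {linear M -> N} -> {linear M' -> N'}} :=
  to_linear (hom_map_subproof f g).

Fact hom_i_subproof M : linear (fun f : {linear k^o -> M} => f 1).
Proof. by []. Qed.
Definition hom_i M : {linear {linear k^o -> M} -> M} :=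
  to_linear (@hom_i_subproof M).

Fact hom_j_subproof M : linear (fun c : k^o => (c : k) *: lin_id M).
Proof. by move=> c x y; rewrite scalerDl scalerA. Qed.
(* k is free on 1, so that this is the k-linear map with j_M(1) = id_M. *)
Definition hom_j M : {linear k^o -> {linear M -> M}} :=
  to_linear (@hom_j_subproof M).

Fact hom_postcomp_subproof M N P (f : {linear N -> P}) :
  linear (fun g : {linear M -> N} => lin_comp f g).
Proof. by move=> c g h; apply: linear_eq => x /=; rewrite linearP. Qed.
Definition hom_postcomp M N P (f : {linear N -> P}) :
    {linear {linear M -> N} -> {linear M -> P}} :=
  to_linear (@hom_postcomp_subproof M N P f).

Fact hom_Gamma_subproof M N P : linear (@hom_postcomp M N P).
Proof. by move=> c f f'; apply: linear_eq => g; apply: linear_eq => x. Qed.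
Definition hom_Gamma M N P :
    {linear {linear N -> P} -> {linear {linear M -> N} -> {linear M -> P}}} :=
  to_linear (@hom_Gamma_subproof M N P).

Definition kMod_closed : skew_closed kMod.
Proof.
refine (@SkewClosed kMod (k^o : lmodType k)
  (fun M N => {linear M -> N} : lmodType k) hom_map _ _
  hom_i _ hom_j _ hom_Gamma _ _ _ _ _ _ _).
- by move=> X Y; apply: linear_eq => f; apply: linear_eq.
- by move=> *; apply: linear_eq => h; apply: linear_eq.
- by move=> X Y f; apply: linear_eq.
- by move=> X Y f; apply: linear_eq => c; apply: linear_eq => x /=;
    rewrite linearZ.
- by move=> *; apply: linear_eq => f; apply: linear_eq => g; apply: linear_eq.
- by move=> *; apply: linear_eq => h; apply: linear_eq => g; apply: linear_eq.
- by apply: linear_eq => c; apply: mulr1.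
- by move=> X Y; apply: linear_eq => f; apply: linear_eq => x /=;
    rewrite scale1r.
- by move=> X Y; apply: linear_eq => c; apply: linear_eq => f;
    apply: linear_eq.
- by move=> X Y; apply: linear_eq => f; apply: linear_eq.
- by move=> U V W X; apply: linear_eq => f; apply: linear_eq => g;
    apply: linear_eq => h; apply: linear_eq.
Defined.

End KMod.

Section AMod.
Variables (k : comPzRingType) (A : algebra k).

(* A left A-module is a k-module with an associative unital k-bilinear action,
   so that forgetting the action is the restriction of scalars to k. *)
Record amod := AModule {
  amod_kmod :> lmodType k;
  lact : A -> amod_kmod -> amod_kmod;
  lact_bilinear : is_bilinear lact;
  lact_unit : forall m, lact unit_elt m = m;
  lact_mul : forall a b m, lact (a ∙ b) m = lact a (lact b m)
}.

Record amod_hom (M N : amod) := AModuleHom {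
  amod_hom_linear :> {linear M -> N};
  amod_hom_act : forall a m,
    amod_hom_linear (lact a m) = lact a (amod_hom_linear m)
}.

Lemma amod_hom_eq (M N : amod) (f g : amod_hom M N) :
  amod_hom_linear f = amod_hom_linear g -> f = g.
Proof.
case: f g => [f fA] [g gA] /= eq_fg; case: g / eq_fg in gA *.
by rewrite (Prop_irrelevance fA gA).
Qed.

Definition amod_id (M : amod) : amod_hom M M :=
  @AModuleHom M M (lin_id M) (fun _ _ => erefl).

Fact amod_comp_subproof (M N P : amod) (g : amod_hom N P) (f : amod_hom M N) :
  forall a m, lin_comp g f (lact a m) = lact a (lin_comp g f m).
Proof. by move=> a m /=; rewrite !amod_hom_act. Qed.
Definition amod_comp (M N P : amod) (g : amod_hom N P) (f : amod_hom M N) :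
  amod_hom M P := AModuleHom (amod_comp_subproof g f).

Definition aMod : category.
Proof.
refine (@Category amod amod_hom amod_id amod_comp _ _ _);
  by move=> *; apply: amod_hom_eq; apply: linear_eq.
Defined.

Definition forget : functor aMod (kMod k) :=
  @Functor aMod (kMod k) amod_kmod amod_hom_linear
    (fun _ => erefl) (fun _ _ _ _ _ => erefl).

Definition is_lift (S : skew_closed aMod) : Prop :=
  strictly_closed S (kMod_closed k) forget.

Definition lift_conditions (eps : A -> k) (delta : A -> A ⊗ A^op) : Prop :=
  [/\ algebra_map (eps : A -> k^o),
      algebra_map delta,
      forall a, \sweedler_(p ⊗ q <- delta a) (eps q *: p) = a,
      forall a, \sweedler_(p ⊗ q <- delta a) (p ∙ q) = eps a *: unit_elt
    & forall a,
        \sweedler_(p ⊗ q <- delta a)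
          \sweedler_(pp ⊗ pq <- delta p)
            \sweedler_(qp ⊗ qq <- delta q) (pp ⊗ qp ⊗ (qq ∙ pq)) =
        \sweedler_(p ⊗ q <- delta a) (p ⊗ q ⊗ unit_elt)].

(* The k-linear map that an element of the lifted internal hom is, through the
   equality of k-modules U[M, V] = Hom_k(UM, UV). *)
Definition underlying (S : skew_closed aMod) (L : is_lift S) (M V : amod)
    (f : (ihom S M V : amod)) : {linear M -> V} :=
  eq_rect (forget (ihom S M V)) (fun X : lmodType k => X : Type) f
    (ihom (kMod_closed k) (forget M) (forget V)) (strict_ihom L M V).

Definition acts_by (S : skew_closed aMod) (L : is_lift S)
    (delta : A -> A ⊗ A^op) : Prop :=
  forall (M V : amod) (a : A) (f : (ihom S M V : amod)) (m : M),
    underlying L (lact a f) m =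
    \sweedler_(p ⊗ q <- delta a) lact p (underlying L f (lact q m)).

End AMod.

(* Main.v *)
Require Import Defs.
From mathcomp Require Import all_boot all_order all_algebra.
From mathcomp Require Import boolp.
Set Implicit Arguments.
Unset Strict Implicit.
Unset Printing Implicit Defensive.
Local Open Scope ring_scope.

Import GRing.Theory.

(** Write [a.f] for the action of [a] on [f : Hom(M, V)], and [eta] for the
    linear map [b |-> 1 ⊗ b] from [A] to the free module [A ⊗ A^op].

    A lift of the closed structure puts an action on every [Hom(M, V)] that is
    natural in [M] and [V] along A-linear maps.  Such an action is determined
    by one family of elements, [delta a = (a.eta)(1)]: evaluation of
    [f : M -> V] at [m] factors through restriction along the orbit map
    [A -> M] of [m], and the restriction of [f] is the composite of [eta] with
    the A-linear map [A ⊗ A^op -> V] extending it.  Hence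
    [(a.f)(m) = a_+ f(a_- m)] ([underlying_act]), which is a form of the Yoneda
    lemma.  Similarly the action on the unit object, whose underlying module is
    [k], is multiplication by [eps a = a.1].

    With this formula, each piece of structure of the lift is one condition:
    that the action is unital and associative says that [delta] is an algebra
    map, and the A-linearity of [i], [j] and [Gamma] says that the three identities
    hold after the elements are made to act on modules.  Evaluating at the
    generators of [A] and of the free modules [A ⊗ A] and [A ⊗ (A ⊗ A)] gives
    the identities themselves ([delta_counit], [delta_antipode],
    [delta_coassoc]).

    Conversely, if [eps] and [delta] satisfy the conditions, the same formulas
    define actions on [Hom(M, V)] and on [k], and the same computations show
    that [Hom(f, g)], for A-linear [f] and [g], and [i], [j] and [Gamma] are
    A-linear.  The axioms and naturality squares of the lifted structure then
    hold because they do for k-modules and the forgetful functor is faithful.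

    In a given lift, the underlying module of an internal hom is only
    propositionally equal to [Hom(M, V)], so the first half works up to
    transport along these equalities. *)

(** * Sums over tensors *)

Section TensorSums.
Variables (k : comPzRingType) (M N : lmodType k).

Lemma linear_tensor_sum (P Q : lmodType k) (h : {linear P -> Q})
    (f : M -> N -> P) (t : M ⊗ N) :
  h (tensor_sum f t) = tensor_sum (fun m n => h (f m n)) t.
Proof. exact: linear_sum. Qed.

Lemma eq_tensor_sum (P : lmodType k) (f g : M -> N -> P) (t : M ⊗ N) :
  (forall m n, f m n = g m n) -> tensor_sum f t = tensor_sum g t.
Proof. by move=> fg; apply: eq_bigr => p _; apply: fg. Qed.

Lemma tensor_hom_eq (P : lmodType k) (f g : {linear (M ⊗ N)%type -> P}) :
  (forall m n, f (m ⊗ n) = g (m ⊗ n)) -> f =1 g.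
Proof. exact/tensor_linear_eq/linearP/linearP. Qed.

Definition tensor_map (P : lmodType k) (f : M -> N -> P)
    (f_bilin : is_bilinear f) : {linear (M ⊗ N)%type -> P} :=
  to_linear (tensor_sum_linear f_bilin).

Lemma bilinear_comp (M' N' P Q : lmodType k) (f : M -> N -> P)
    (l : {linear M' -> M}) (r : {linear N' -> N}) (h : {linear P -> Q}) :
  is_bilinear f -> is_bilinear (fun m n => h (f (l m) (r n))).
Proof.
by case=> fl fr; split=> [n c x y|m c x y]; rewrite linearP ?fl ?fr linearP.
Qed.

End TensorSums.

(** * Sweedler sums *)

Section Sweedler.
Variables (k : comPzRingType) (A : algebra k).
Implicit Types (t : A ⊗ A^op) (P Q : lmodType k).

Lemma linear_sweedler P Q (h : {linear P -> Q}) t (f : A -> A -> P) :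
  h (sweedler t f) = \sweedler_(p ⊗ q <- t) h (f p q).
Proof. exact: linear_tensor_sum. Qed.

Lemma eq_sweedler P t (f g : A -> A -> P) :
  (forall p q, f p q = g p q) -> sweedler t f = sweedler t g.
Proof. exact: eq_tensor_sum. Qed.

Lemma sweedler_unit P (f : A -> A -> P) : is_bilinear f ->
  sweedler unit_elt f = f unit_elt unit_elt.
Proof. exact: tensor_sum_pure. Qed.

Lemma sweedler_linear P (f : A -> A -> P) : is_bilinear f ->
  linear (fun t : A ⊗ A^op => sweedler t f).
Proof. exact: tensor_sum_linear. Qed.

(** The second factors are multiplied in the opposite algebra, hence in the
    reversed order in [A]. *)
Lemma sweedler_mul P (f : A -> A -> P) s t : is_bilinear f ->
  sweedler (s ∙ t) f =
  \sweedler_(p ⊗ q <- s) \sweedler_(p' ⊗ q' <- t) f (p ∙ p') (q' ∙ q).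
Proof.
move=> fb; pose F := tensor_map (fb : is_bilinear (f : A -> A^op -> P)).
rewrite -[LHS]/(F _) [s ∙ t]/(tensor_mul s t) /tensor_mul linear_tensor_sum.
apply: eq_tensor_sum => p q; rewrite linear_tensor_sum.
by apply: eq_tensor_sum => p' q'; apply: tensor_sum_pure.
Qed.

End Sweedler.

(** * Regular and free modules *)

Section Modules.
Variables (k : comPzRingType) (A : algebra k).
Implicit Types (M V : amod A) (N : lmodType k).

Definition action M (a : A) : {linear M -> M} :=
  to_linear ((lact_bilinear M).2 a).

Definition orbit_linear M (m : M) : {linear A -> M} :=
  to_linear ((lact_bilinear M).1 m).

(** What allows [p f(q m)] to be summed over an element of [A ⊗ A^op]. *)
Lemma sandwich_bilinear M V (f : {linear M -> V}) (m : M) :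
  is_bilinear (fun p q : A => lact p (f (lact q m))).
Proof.
exact: (bilinear_comp (lin_id A) (lin_comp f (orbit_linear m)) (lin_id V)
  (lact_bilinear V)).
Qed.

Definition regular : amod A :=
  AModule (@amul_bilinear k A) (@amul1l k A)
    (fun a b m => esym (amulA a b m)).

Definition orbit M (m : M) : amod_hom regular M :=
  @AModuleHom k A regular M (orbit_linear m) (fun a b => lact_mul a b m).

Section Free.
Variable N : lmodType k.

Fact free_act_bilinear_subproof (a : A) :
  is_bilinear (fun (b : A) (n : N) => (a ∙ b) ⊗ n : A ⊗ N).
Proof.
exact: (bilinear_comp (action regular a) (lin_id N) (lin_id (A ⊗ N)%type)
  (pure_bilinear A N)).
Qed.

Definition free_act (a : A) : {linear (A ⊗ N)%type -> (A ⊗ N)%type} :=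
  tensor_map (free_act_bilinear_subproof a).

Lemma free_act_pure (a b : A) (n : N) : free_act a (b ⊗ n) = (a ∙ b) ⊗ n.
Proof. exact/tensor_sum_pure/free_act_bilinear_subproof. Qed.

Fact free_act_bilinear : is_bilinear (fun a => free_act a).
Proof.
split=> [t|a]; last exact: linearP.
apply: (tensor_sum_family (F := fun a b n => (a ∙ b) ⊗ n)) => b n c a a'.
by rewrite (@amul_bilinear k A).1 (pure_bilinear A N).1.
Qed.

Fact free_act_unit t : free_act unit_elt t = t.
Proof.
apply: (tensor_hom_eq (g := lin_id _)) => b n.
by rewrite free_act_pure amul1l.
Qed.

Fact free_act_mul a b t : free_act (a ∙ b) t = free_act a (free_act b t).
Proof.
apply: (tensor_hom_eq (g := lin_comp (free_act a) (free_act b))) => c n.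
rewrite -[RHS]/(free_act a (free_act b (c ⊗ n))).
by rewrite !free_act_pure amulA.
Qed.

Definition free : amod A :=
  AModule free_act_bilinear free_act_unit free_act_mul.

Definition free_in : {linear N -> free} :=
  to_linear ((pure_bilinear A N).2 unit_elt).

Lemma free_act_in (a : A) (n : N) : lact a (free_in n) = a ⊗ n.
Proof. by rewrite -[LHS]/(free_act a _) free_act_pure amul1r. Qed.

Variables (V : amod A) (h : {linear N -> V}).

Fact free_ext_bilinear : is_bilinear (fun (a : A) (n : N) => lact a (h n)).
Proof.
exact: (bilinear_comp (lin_id A) h (lin_id V) (lact_bilinear V)).
Qed.

Fact free_ext_act (a : A) (t : free) :
  tensor_map free_ext_bilinear (lact a t) =
  lact a (tensor_map free_ext_bilinear t).
Proof.
set e := tensor_map _; move: t.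
apply: (tensor_hom_eq (f := lin_comp e (free_act a))
  (g := lin_comp (action V a) e)) => b n.
rewrite -[LHS]/(e (free_act a (b ⊗ n))) free_act_pure.
by rewrite /= !tensor_sum_pure ?lact_mul //; exact: free_ext_bilinear.
Qed.

Definition free_ext : amod_hom free V :=
  @AModuleHom k A free V (tensor_map free_ext_bilinear) free_ext_act.

Lemma free_ext_in (n : N) : free_ext (free_in n) = h n.
Proof.
rewrite -[LHS]/(tensor_sum _ (_ ⊗ _)) tensor_sum_pure ?lact_unit //.
exact: free_ext_bilinear.
Qed.

End Free.
End Modules.

(** * Transport along equalities of modules *)

Section Transport.
Variable k : comPzRingType.
Implicit Types M N : lmodType k.

Definition transport M N (e : M = N) (x : M) : N :=
  eq_rect M (fun X : lmodType k => X : Type) x N e.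

Lemma transport_linear M N (e : M = N) : linear (transport e).
Proof. by case: N / e. Qed.

Lemma transportZ M N (e : M = N) c x : transport e (c *: x) = c *: transport e x.
Proof. by case: N / e. Qed.

Lemma transportK M N (e : M = N) : cancel (transport e) (transport (esym e)).
Proof. by case: N / e. Qed.

Lemma transportVK M N (e : M = N) : cancel (transport (esym e)) (transport e).
Proof. by case: N / e. Qed.

Lemma transport_trans M N P (e : M = N) (e' : N = P) x :
  transport (etrans e e') x = transport e' (transport e x).
Proof. by case: P / e'. Qed.

(** [Hom(M, N)] as a function of modules, so that equalities of [M] and [N]
    can be applied inside it. *)
Definition hom_module M N : lmodType k := {linear M -> N}.

Lemma transport_hom M M' N N' (eM : M = M') (eN : N = N') (h : {linear M -> N})
    (x : M) :
  (transport (f_equal2 hom_module eM eN) h : {linear M' -> N'})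
    (transport eM x) = transport eN (h x).
Proof.
case: M' / eM; case: N' / eN.
by rewrite (Prop_irrelevance (f_equal2 _ _ _) erefl).
Qed.

(** Equality proofs are irrelevant, so that a heterogeneous equality of maps
    becomes a commutative square for whichever equalities of sources and of
    targets are at hand. *)
Lemma mor_eq_transport M M' N N' (f : {linear M -> N}) (f' : {linear M' -> N'})
    (eM : M = M') (eN : N = N') (x : M) :
  @mor_eq (kMod k) M N f M' N' f' -> f' (transport eM x) = transport eN (f x).
Proof.
move=> ff'; move: eM eN; case: ff' => eM eN.
by rewrite (Prop_irrelevance eM erefl) (Prop_irrelevance eN erefl).
Qed.

End Transport.

(** * The maps [eps] and [delta] of a lift *)

Section LiftToAlgebra.
Variables (k : comPzRingType) (A : algebra k).
Variables (S : skew_closed (aMod A)) (L : is_lift S).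
Implicit Types (M V X Y Z : amod A).

Notation "[[ M , V ]]" := (ihom S M V : amod A).
Notation one := (sc_one S : amod A).

Let one_eq : amod_kmod one = k^o := strict_one L.
Let hom_eq M V : amod_kmod [[M, V]] = hom_module M V := strict_ihom L M V.

(** The unit object of the lift is [k] up to an equality of modules; [scalar]
    is the resulting identification. *)
Definition scalar (c : k) : one := transport (esym one_eq) (c : k^o).

Definition lifted M V (f : {linear M -> V}) : [[M, V]] :=
  transport (esym (hom_eq M V)) f.

Lemma underlying_linear M V : linear (@underlying k A S L M V).
Proof. exact: transport_linear. Qed.

Lemma liftedK M V (f : {linear M -> V}) : underlying L (lifted f) = f.
Proof. exact: transportVK. Qed.

Lemma underlyingK M V (f : [[M, V]]) : lifted (underlying L f) = f.
Proof. exact: transportK. Qed.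

Lemma underlying_map X X' Y Y' (f : amod_hom X' X) (g : amod_hom Y Y')
    (h : [[X, Y]]) :
  underlying L ((ihom_map S f g : amod_hom [[X, Y]] [[X', Y']]) h) =
  lin_comp g (lin_comp (underlying L h) f).
Proof.
have /mor_eq_transport e := strict_ihom_map L f g.
exact: esym (e (hom_eq X Y) (hom_eq X' Y') h).
Qed.

Lemma underlying_i X (f : [[one, X]]) :
  (sc_i S X : amod_hom [[one, X]] X) f = underlying L f (scalar 1).
Proof.
have /mor_eq_transport e := strict_i L X.
have {}e := e (etrans (hom_eq one X) (f_equal2 (@hom_module k) one_eq erefl))
  erefl f.
apply: etrans (esym e) _; rewrite transport_trans.
have := transport_hom one_eq erefl (underlying L f) (scalar 1).
by rewrite transportVK.
Qed.

Lemma underlying_j X (c : k) :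
  underlying L ((sc_j S X : amod_hom one [[X, X]]) (scalar c)) =
  c *: lin_id X.
Proof.
have /mor_eq_transport e := strict_j L X.
apply: etrans (esym (e one_eq (hom_eq X X) (scalar c))) _.
by rewrite transportVK.
Qed.

(** Two nested internal homs make two further transports, along the equalities
    for [[X, Y]] and [[X, Z]], which [transport_hom] absorbs. *)
Lemma underlying_Gamma X Y Z (f : [[Y, Z]]) (g : [[X, Y]]) :
  underlying L (underlying L
    ((sc_Gamma S X Y Z : amod_hom [[Y, Z]] [[[[X, Y]], [[X, Z]]]]) f) g) =
  lin_comp (underlying L f) (underlying L g).
Proof.
have /mor_eq_transport e := strict_Gamma L X Y Z.
have {}e := e (hom_eq Y Z) (etrans (hom_eq [[X, Y]] [[X, Z]])
  (f_equal2 (@hom_module k) (hom_eq X Y) (hom_eq X Z))) f.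
rewrite transport_trans in e.
apply: etrans (esym (transport_hom (hom_eq X Y) (hom_eq X Z) _ g)) _.
exact: (congr1 (fun h : {linear hom_module X Y -> hom_module X Z} =>
                  h (underlying L g)) (esym e)).
Qed.

Definition eps (a : A) : k := transport one_eq (lact a (scalar 1)).

(* The source of [free_in] must be seen as an A-module for [lifted] to apply. *)
Let unit_map : {linear regular A -> free A A^op} := free_in A A^op.

Definition delta (a : A) : A ⊗ A^op :=
  underlying L (lact a (lifted unit_map)) unit_elt.

Lemma act_scalar (a : A) : lact a (scalar 1) = scalar (eps a).
Proof. exact: esym (transportK one_eq _). Qed.

Lemma scalarE (c : k) : scalar c = c *: scalar 1.
Proof. by rewrite -transportZ [c *: _]mulr1. Qed.

Lemma eps_algebra_map : algebra_map (eps : A -> k^o).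
Proof.
split=> [c a b||a b]; rewrite [LHS]/eps.
- by rewrite (lact_bilinear one).1 transport_linear.
- by rewrite lact_unit transportVK.
- rewrite lact_mul act_scalar scalarE -[lact a _]/(action one a _) linearZ /=.
  by rewrite act_scalar transportZ transportVK [LHS]mulrC.
Qed.

(** The Yoneda argument: evaluation at [m] is restriction along the orbit map
    of [m] followed by evaluation at 1, and the restricted map is the image of
    [unit_map] under the A-linear map that freely extends it. *)
Lemma underlying_act M V (a : A) (f : [[M, V]]) (m : M) :
  underlying L (lact a f) m =
  \sweedler_(p ⊗ q <- delta a) lact p (underlying L f (lact q m)).
Proof.
pose h : {linear A^op -> V} := lin_comp (underlying L f) (orbit m).
have restr g : underlying L g m =
    underlying L ((ihom_map S (orbit m) (amod_id V) :
      amod_hom [[M, V]] [[regular A, V]]) g) unit_elt.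
  by rewrite underlying_map /= lact_unit.
have ext g : underlying L ((ihom_map S (amod_id (regular A)) (free_ext h) :
      amod_hom [[regular A, free A A^op]] [[regular A, V]]) g) unit_elt =
    free_ext h (underlying L g unit_elt).
  by rewrite underlying_map.
rewrite restr amod_hom_act.
set f' := (X in lact a X).
suff -> : f' = (ihom_map S (amod_id (regular A)) (free_ext h) :
      amod_hom [[regular A, free A A^op]] [[regular A, V]])
        (lifted unit_map).
  by rewrite -amod_hom_act ext.
rewrite -[LHS]underlyingK -[RHS]underlyingK !underlying_map liftedK.
congr lifted; apply: linear_eq => b; rewrite -[RHS]/(free_ext h (free_in _ _ b)).
by rewrite free_ext_in.
Qed.

(** [delta (a ∙ b)] is the value at 1 of [a.(b.unit_map)].  The inner action is
    evaluated at [q] and multiplies it on the left by its own second factor,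
    whence the opposite multiplication. *)
Lemma delta_algebra_map : algebra_map delta.
Proof.
split=> [c a b||a b]; rewrite /delta.
- by rewrite (lact_bilinear [[_, _]]).1 underlying_linear.
- by rewrite lact_unit liftedK.
rewrite lact_mul underlying_act; apply: eq_sweedler => p q.
rewrite underlying_act liftedK -[LHS]/(action _ _ _) linear_sweedler.
apply: eq_sweedler => p' q'.
by rewrite -[LHS]/(lact p _) -lact_mul free_act_in /= amul1r.
Qed.

(** The linearity of [i] on the maps from the unit object to [A], applied to the
    one that sends 1 to [unit_elt]. *)
Lemma delta_counit (a : A) :
  \sweedler_(p ⊗ q <- delta a) (eps q *: p) = a.
Proof.
have point_linear :
    linear (fun c : one => (transport one_eq c : k) *: (unit_elt : A)).
  by move=> c x y; rewrite transport_linear scalerDl scalerA.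
pose f : {linear one -> regular A} := to_linear point_linear.
have f_scalar c : f (scalar c) = c *: unit_elt by rewrite /= transportVK.
have := amod_hom_act (sc_i S (regular A) : amod_hom [[one, regular A]] _) a
  (lifted f).
rewrite !underlying_i underlying_act liftedK f_scalar scale1r.
rewrite [RHS]amul1r; apply: etrans; apply: eq_sweedler => p q.
rewrite act_scalar f_scalar -[RHS]/(action (regular A) p _) linearZ.
by congr (_ *: _); rewrite -[RHS]/(p ∙ unit_elt) amul1r.
Qed.

(** The linearity of [j] for the regular module, evaluated at [unit_elt]. *)
Lemma delta_antipode (a : A) :
  \sweedler_(p ⊗ q <- delta a) (p ∙ q) = eps a *: unit_elt.
Proof.
have := amod_hom_act (sc_j S (regular A) : amod_hom one _) a (scalar 1).
rewrite act_scalar =>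
  /(congr1 (fun f : [[regular A, regular A]] => underlying L f unit_elt)).
rewrite underlying_act !underlying_j => ->; apply: eq_sweedler => p q.
by rewrite /= scale1r amul1r.
Qed.

(** The linearity of [Gamma]: the action on [f ∘ -] involves three uses of
    [delta], on the outer internal hom, on [[X, Z]] and on [[X, Y]]. *)
Lemma Gamma_act X Y Z (a : A) (f : [[Y, Z]]) (g : [[X, Y]]) (x : X) :
  \sweedler_(p ⊗ q <- delta a)
    \sweedler_(pp ⊗ pq <- delta p)
      \sweedler_(qp ⊗ qq <- delta q)
        lact pp (underlying L f (lact qp (underlying L g (lact (qq ∙ pq) x)))) =
  \sweedler_(p ⊗ q <- delta a)
    lact p (underlying L f (lact q (underlying L g x))).
Proof.
have := amod_hom_act
  (sc_Gamma S X Y Z : amod_hom [[Y, Z]] [[[[X, Y]], [[X, Z]]]]) a f.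
move=> /(congr1 (fun h : [[[[X, Y]], [[X, Z]]]] =>
  underlying L (underlying L h g) x)).
rewrite underlying_Gamma /= underlying_act => ->.
rewrite underlying_act.
pose ev (h : [[X, Z]]) := underlying L h x.
have ev_linear : linear ev by move=> c h h'; rewrite /ev underlying_linear.
rewrite -[RHS]/(to_linear ev_linear _) linear_sweedler.
apply: eq_sweedler => p q; rewrite /= /ev underlying_act.
apply: eq_sweedler => pp pq; rewrite underlying_Gamma /= underlying_act.
pose h := lin_comp (action Z pp) (underlying L f).
rewrite -[RHS]/(h _) linear_sweedler.
by apply: eq_sweedler => qp qq; rewrite lact_mul.
Qed.

(** For the free modules below, [p f(q g(b))] is the pure tensor of [p], [q] and
    [b], so that [Gamma_act] becomes an identity in [A ⊗ (A ⊗ A)]. *)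
Lemma delta_coassoc (a : A) :
  \sweedler_(p ⊗ q <- delta a)
    \sweedler_(pp ⊗ pq <- delta p)
      \sweedler_(qp ⊗ qq <- delta q) (pp ⊗ qp ⊗ (qq ∙ pq)) =
  \sweedler_(p ⊗ q <- delta a) (p ⊗ q ⊗ unit_elt).
Proof.
pose g : {linear regular A -> free A A} := free_in A A.
pose f : {linear free A A -> free A (A ⊗ A)%type} := free_in A (A ⊗ A)%type.
have fgE p q b : lact p (f (lact q (g b))) = p ⊗ q ⊗ b.
  by rewrite [lact q _]free_act_in free_act_in.
have := Gamma_act a (lifted f) (lifted g) (unit_elt : regular A).
rewrite !liftedK => fg.
transitivity (\sweedler_(p ⊗ q <- delta a) lact p (f (lact q (g unit_elt)))).
  rewrite -[RHS]fg; apply: eq_sweedler => p q; apply: eq_sweedler => pp pq.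
  by apply: eq_sweedler => qp qq; rewrite fgE [lact _ _]amul1r.
by apply: eq_sweedler => p q; rewrite fgE.
Qed.

Lemma lift_conditions_of_lift : lift_conditions eps delta.
Proof.
split; [exact: eps_algebra_map | exact: delta_algebra_map
  | exact: delta_counit | exact: delta_antipode | exact: delta_coassoc].
Qed.

End LiftToAlgebra.

(** * The lift defined by [eps] and [delta] *)

Section AlgebraToLift.
Variables (k : comPzRingType) (A : algebra k).
Variables (eps : A -> k) (delta : A -> A ⊗ A^op).
Hypothesis conditions : lift_conditions eps delta.
Implicit Types (M V X Y Z : amod A).

Let eps_map : algebra_map (eps : A -> k^o). Proof. by case: conditions. Qed.
Let delta_map : algebra_map delta. Proof. by case: conditions. Qed.

Section HomAction.
Variables M V : amod A.

Fact hom_act_subproof (a : A) (f : {linear M -> V}) :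
  linear (fun m => \sweedler_(p ⊗ q <- delta a) lact p (f (lact q m))).
Proof.
apply: (tensor_sum_family (F := fun m p q => lact p (f (lact q m)))) => p q.
exact: (linearP (lin_comp (action V p) (lin_comp f (action M q)))).
Qed.

Definition hom_act (a : A) (f : {linear M -> V}) : {linear M -> V} :=
  to_linear (hom_act_subproof a f).

Fact hom_act_bilinear : is_bilinear hom_act.
Proof.
split=> [f c a b|a c f g]; apply: linear_eq => m /=.
  by case: delta_map => -> _ _; apply/sweedler_linear/sandwich_bilinear.
apply: (tensor_sum_family
  (F := fun (f : hom_module M V) p q => lact p (f (lact q m)))) => p q d u v.
by rewrite [LHS](lact_bilinear V).2.
Qed.

Fact hom_act_unit f : hom_act unit_elt f = f.
Proof.
apply: linear_eq => m /=; case: delta_map => _ -> _.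
by rewrite (sweedler_unit (sandwich_bilinear f m)) !lact_unit.
Qed.

Fact hom_act_mul a b f : hom_act (a ∙ b) f = hom_act a (hom_act b f).
Proof.
apply: linear_eq => m /=; case: delta_map => _ _ ->.
rewrite (sweedler_mul _ _ (sandwich_bilinear f m)); apply: eq_sweedler => p q.
rewrite -[RHS]/(action V p _) linear_sweedler; apply: eq_sweedler => p' q'.
by rewrite /= !lact_mul.
Qed.

Definition hom_amod : amod A :=
  AModule hom_act_bilinear hom_act_unit hom_act_mul.

End HomAction.

Fact one_act_bilinear : is_bilinear (fun (a : A) (c : k^o) => eps a * c : k^o).
Proof.
split=> [c d a b|a d b c].
  by case: eps_map => -> _ _; rewrite mulrDl -mulrA.
by rewrite mulrDr mulrCA.
Qed.

Fact one_act_unit (c : k^o) : eps unit_elt * c = c.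
Proof. by case: eps_map => _ -> _; rewrite [LHS]mul1r. Qed.

Fact one_act_mul (a b : A) (c : k^o) : eps (a ∙ b) * c = eps a * (eps b * c).
Proof. by case: eps_map => _ _ ->; rewrite mulrA. Qed.

Definition one_amod : amod A :=
  AModule one_act_bilinear one_act_unit one_act_mul.

Fact hom_map_act X X' Y Y' (f : amod_hom X' X) (g : amod_hom Y Y')
    (a : A) (h : hom_amod X Y) :
  hom_map f g (lact a h) = lact a (hom_map f g h : hom_amod X' Y').
Proof.
apply: linear_eq => m /=; rewrite linear_sweedler.
by apply: eq_sweedler => p q; rewrite !amod_hom_act.
Qed.

Fact hom_i_act X (a : A) (f : hom_amod one_amod X) :
  hom_i X (lact a f) = lact a (hom_i X f).
Proof.
case: conditions => _ _ counit _ _.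
rewrite /= -[a in RHS]counit -[RHS]/(orbit_linear (f 1) _) linear_sweedler.
apply: eq_sweedler => p q.
by rewrite linearZ [RHS]linearZ -[LHS]/(action X p (eps q *: f 1)) linearZ.
Qed.

Fact hom_j_act X (a : A) (c : one_amod) :
  hom_j X (lact a c) = lact a (hom_j X c : hom_amod X X).
Proof.
case: conditions => _ _ _ antipode _; apply: linear_eq => x /=.
pose h : {linear A -> X} := hom_scale (c : k) (orbit_linear x).
transitivity (h (eps a *: unit_elt)).
  by rewrite linearZ /= lact_unit scalerA.
rewrite -antipode linear_sweedler; apply: eq_sweedler => p q.
by rewrite /= lact_mul -[RHS]/(action X p _) linearZ.
Qed.

(** Both sides are values of one linear map, [b ⊗ c ⊗ d |-> b f(c g(d x))], at
    the two members of the third identity. *)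
Fact hom_Gamma_act X Y Z (a : A) (f : hom_amod Y Z) :
  hom_Gamma X Y Z (lact a f) =
  lact a (hom_Gamma X Y Z f : hom_amod (hom_amod X Y) (hom_amod X Z)).
Proof.
case: conditions => _ _ _ _ coassoc.
apply: linear_eq => g; apply: linear_eq => x /=.
pose inner := tensor_map (sandwich_bilinear g x).
have outer_bilinear :
    is_bilinear (fun (b : A) (t : A ⊗ A) => lact b (f (inner t))).
  exact: (bilinear_comp (lin_id A) (lin_comp f inner) (lin_id Z)
    (lact_bilinear Z)).
pose outer := tensor_map outer_bilinear.
have outerE p q r : outer (p ⊗ q ⊗ r) = lact p (f (lact q (g (lact r x)))).
  rewrite /= tensor_sum_pure; last exact: outer_bilinear.
  by rewrite /= tensor_sum_pure //; apply: sandwich_bilinear.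
have eval_linear : linear (fun h : hom_module X Z => h x) by [].
rewrite -[RHS]/(to_linear eval_linear _) linear_sweedler.
have := congr1 outer (coassoc a); rewrite !linear_sweedler => outer_a.
transitivity (\sweedler_(p ⊗ q <- delta a) outer (p ⊗ q ⊗ unit_elt)).
  by apply: eq_sweedler => p q; rewrite outerE lact_unit.
rewrite -outer_a; apply: eq_sweedler => p q; rewrite linear_sweedler.
apply: eq_sweedler => pp pq; rewrite linear_sweedler.
pose h := lin_comp (action Z pp) f.
rewrite -[RHS]/(h _) linear_sweedler; apply: eq_sweedler => qp qq.
by rewrite outerE lact_mul.
Qed.

(** Transparent, so that the forgetful functor is strictly closed by
    computation. *)
Definition amod_closed : skew_closed (aMod A).
Proof.
refine (@SkewClosed (aMod A) one_amod hom_amod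
  (fun X X' Y Y' f g => @AModuleHom k A (hom_amod X Y) (hom_amod X' Y')
    (hom_map f g) (hom_map_act f g)) _ _
  (fun X => @AModuleHom k A (hom_amod one_amod X) X (hom_i X) (@hom_i_act X)) _
  (fun X => @AModuleHom k A one_amod (hom_amod X X) (hom_j X) (@hom_j_act X)) _
  (fun X Y Z => @AModuleHom k A (hom_amod Y Z)
    (hom_amod (hom_amod X Y) (hom_amod X Z)) (hom_Gamma X Y Z)
    (@hom_Gamma_act X Y Z)) _ _ _ _ _ _ _).
- by move=> X Y; apply/amod_hom_eq/(@ihom_map_id _ (kMod_closed k)).
- by move=> *; apply/amod_hom_eq/(@ihom_map_comp _ (kMod_closed k)).
- by move=> *; apply/amod_hom_eq/(@sc_i_natural _ (kMod_closed k)).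
- by move=> *; apply/amod_hom_eq/(@sc_j_dinatural _ (kMod_closed k)).
- by move=> *; apply/amod_hom_eq/(@sc_Gamma_natural _ (kMod_closed k)).
- by move=> *; apply/amod_hom_eq/(@sc_Gamma_dinatural _ (kMod_closed k)).
- by apply/amod_hom_eq/(@sc_ax_ij _ (kMod_closed k)).
- by move=> *; apply/amod_hom_eq/(@sc_ax_ijGamma _ (kMod_closed k)).
- by move=> *; apply/amod_hom_eq/(@sc_ax_Gammaj _ (kMod_closed k)).
- by move=> *; apply/amod_hom_eq/(@sc_ax_iGamma _ (kMod_closed k)).
- by move=> *; apply/amod_hom_eq/(@sc_ax_Gamma _ (kMod_closed k)).
Defined.

Lemma amod_closed_is_lift : is_lift amod_closed.
Proof. by split. Qed.

Lemma amod_closed_acts_by : acts_by amod_closed_is_lift delta.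
Proof.
move=> M V a f m; rewrite /underlying.
by rewrite (Prop_irrelevance (strict_ihom amod_closed_is_lift M V) erefl).
Qed.

End AlgebraToLift.

Theorem theorem3p12 (k : comPzRingType) (A : algebra k) :
  [/\ (exists S : skew_closed (aMod A), is_lift S) <->
      (exists (eps : A -> k) (delta : A -> A ⊗ A^op),
         lift_conditions eps delta),
      forall (S : skew_closed (aMod A)) (L : is_lift S),
        exists (eps : A -> k) (delta : A -> A ⊗ A^op),
          lift_conditions eps delta /\ acts_by L delta
    & forall (eps : A -> k) (delta : A -> A ⊗ A^op),
        lift_conditions eps delta ->
        exists (S : skew_closed (aMod A)) (L : is_lift S), acts_by L delta].
Proof.
split.
- split=> [[S L]|[eps [delta conditions]]].
    by exists (eps L), (delta L); apply: lift_conditions_of_lift.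
  by exists (amod_closed conditions); apply: amod_closed_is_lift.
- move=> S L; exists (eps L), (delta L).
  by split; [apply: lift_conditions_of_lift | apply: underlying_act].
- move=> eps delta conditions; exists (amod_closed conditions).
  by exists (amod_closed_is_lift conditions); apply: amod_closed_acts_by.
Qed.
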